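(* Let $p>5$ be a prime, $F$ an infinite field of characteristic $p$, $G$ a cyclic group of order $p$, and $V_5$ the indecomposable $G$-module over $F$ of dimension $5$, with $F[V_5]=F[x_1,\dots,x_5]$. Then for every monomial order $>$ with $x_1>x_2>x_3>x_4>x_5$, $$\operatorname{gin}_>(H(V_5))=\operatorname{In}_>(H(V_5)).$$
   Context: $V_5$ is the $5$-dimensional $G$-module on which a generator of $G$ acts by a single Jordan block with $1$'s on the diagonal. $F[V_5]=S(V_5^* )$ is the symmetric algebra on $V_5^*$, a polynomial ring on a basis $x_1,\dots,x_5$ of $V_5^*$. The Hilbert ideal $H(V_5)$ is the ideal of $F[V_5]$ generated by all homogeneous $G$-invariants of positive degree. It is a known result that, for $p>5$ and a suitable (triangular) basis $x_1,\dots,x_5$ of $V_5^*$, which is fixed here, $H(V_5)$ is generated by $$\{x_1, x_2^2, x_3^2-2x_2x_4-x_2x_3, x_2x_3x_4, x_2x_4^{p-4}, x_3x_4^{p-3}, x_4^{p-1}, x_5^p\}.$$ For a homogeneous ideal $I$ and monomial order $>$, $\operatorname{In}_>(I)$ is the ideal generated by initial monomials of elements of $I$, and $\operatorname{gin}_>(I)$ is the monomial ideal $J$ such that $\operatorname{In}_>(\alpha(I))=J$ for all $\alpha$ in a nonempty Zariski open subset of the group $GL_5(F)$ of invertible linear substitutions of the variables. *)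

(* Defs.v *)
From mathcomp Require Import all_boot all_order all_algebra all_fingroup.
From mathcomp Require Import cyclic mxrepresentation.
From mathcomp Require Export mpoly.

Set Implicit Arguments.
Unset Strict Implicit.
Unset Printing Implicit Defensive.

Import GRing.Theory.
Local Open Scope ring_scope.

Definition ideal_gen (R : comNzRingType) (S : R -> Prop) (f : R) : Prop :=
  exists2 s : seq (R * R),
    (forall c, c \in s -> S c.2) & f = \sum_(c <- s) c.1 * c.2.

Definition infinite_type (T : eqType) : Prop :=
  forall s : seq T, exists x : T, x \notin s.

(* The substitution 'X_j |-> \sum_i A i j *: 'X_i.  As functions of a row
   vector, lin_subst A f : v |-> f (v *m A). *)
Definition lin_subst (F : fieldType) (n : nat) (A : 'M[F]_n)
    (f : {mpoly F[n]}) : {mpoly F[n]} :=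
  f \mPo [tuple \sum_(i < n) A i j *: 'X_i | j < n].

(* mo m1 m2 reads 'X_[m1] <= 'X_[m2]. *)
Record monomial_order (n : nat) (mo : rel 'X_{1..n}) : Prop := {
  mo_refl : reflexive mo;
  mo_anti : antisymmetric mo;
  mo_trans : transitive mo;
  mo_total : total mo;
  mo_min : forall m, mo 0%MM m;
  mo_add : forall m m1 m2, mo m1 m2 -> mo (m + m1)%MM (m + m2)%MM
}.

Definition is_initial (F : fieldType) (n : nat) (mo : rel 'X_{1..n})
    (f : {mpoly F[n]}) (m : 'X_{1..n}) : Prop :=
  m \in msupp f /\ (forall m', m' \in msupp f -> mo m' m).

Definition initial_ideal (F : fieldType) (n : nat) (mo : rel 'X_{1..n})
    (I : {mpoly F[n]} -> Prop) : {mpoly F[n]} -> Prop :=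
  ideal_gen (fun g => exists f m, [/\ I f, is_initial mo f m & g = 'X_[m]]).

(* The polynomials f range over F[t_11, ..., t_nn] and are evaluated at the
   entries of the matrix. *)
Definition zariski_open_GL (F : fieldType) (n : nat) (U : 'M[F]_n -> Prop)
    : Prop :=
  exists S : {mpoly F[n * n]} -> Prop, forall A : 'M[F]_n,
    U A <-> A \in unitmx /\
            (exists2 f, S f & f.@[fun k => mxvec A 0 k] != 0).

(* J = gin(I); by is_gin_unique below there is at most one such J when F is
   infinite. *)
Definition is_gin (F : fieldType) (n : nat) (mo : rel 'X_{1..n})
    (I J : {mpoly F[n]} -> Prop) : Prop :=
  exists U : 'M[F]_n -> Prop,
    [/\ zariski_open_GL U, (exists A, U A) &
        forall A, U A -> forall g,
          initial_ideal mo (fun h => exists2 f, I f & h = lin_subst A f) g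
          <-> J g].

Definition jordan1 (F : fieldType) (n : nat) : 'M[F]_n :=
  \matrix_(i, j) ((i == j) || (i.+1 == j :> nat))%:R.

Definition is_jordan_module (F : fieldType) (n : nat) (gT : finGroupType)
    (G : {group gT}) (rG : mx_representation F G n) : Prop :=
  exists2 g, generator G g &
    similar_in unitmx (rG g) (jordan1 F n).

(* The row vectors 'rV_n are the module, and 'X_0, ..., 'X_(n-1) the basis of
   the dual given by the coordinate functions; choosing another basis of the
   dual amounts to conjugating rG. *)
Definition mpoly_invariant (F : fieldType) (n : nat) (gT : finGroupType)
    (G : {group gT}) (rG : mx_representation F G n) (f : {mpoly F[n]}) : Prop :=
  forall g, g \in G -> lin_subst (rG g) f = f.

Definition hilbert_ideal (F : fieldType) (n : nat) (gT : finGroupType)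
    (G : {group gT}) (rG : mx_representation F G n) : {mpoly F[n]} -> Prop :=
  ideal_gen (fun f => mpoly_invariant rG f /\
                      (exists2 d, (0 < d)%N & f \is d.-homog)).

(* The basis of coordinate functions is triangular: g sends 'X_j to a
   combination of 'X_0, ..., 'X_j. *)
Definition triangular_basis (F : fieldType) (n : nat) (gT : finGroupType)
    (G : {group gT}) (rG : mx_representation F G n) : Prop :=
  forall g, g \in G -> is_trig_mx (rG g)^T.

Definition hilbert_gens_V5 (F : fieldType) (p : nat) : seq {mpoly F[5]} :=
  let x1 := 'X_(inord 0) in let x2 := 'X_(inord 1) in
  let x3 := 'X_(inord 2) in let x4 := 'X_(inord 3) in
  let x5 := 'X_(inord 4) in
  [:: x1; x2 ^+ 2; x3 ^+ 2 - 2%:R * x2 * x4 - x2 * x3; x2 * x3 * x4;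
      x2 * x4 ^+ (p - 4); x3 * x4 ^+ (p - 3); x4 ^+ (p - 1); x5 ^+ p].

Lemma meval_line (F : fieldType) (k : nat) (f : {mpoly F[k]}) (a b : 'I_k -> F) :
  exists q : {poly F}, forall t, q.[t] = f.@[fun i => a i + t * b i].
Proof.
exists (mmap (@polyC F) (fun i => (a i)%:P + 'X * (b i)%:P) f) => t.
rewrite mevalE /mmap horner_sum; apply: eq_bigr => m _.
rewrite hornerM hornerC; congr (_ * _); rewrite /mmap1 horner_prod.
by apply: eq_bigr => i _; rewrite horner_exp !hornerE.
Qed.

Lemma det_line (F : fieldType) (n : nat) (A B : 'M[F]_n) :
  exists q : {poly F}, forall t, q.[t] = \det (A + t *: B).
Proof.
exists (\det (map_mx polyC A + 'X *: map_mx polyC B)) => t.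
rewrite -horner_evalE -det_map_mx; congr (\det _).
by apply/matrixP => i j; rewrite !mxE /= /horner_eval !hornerE.
Qed.

Lemma infinite_poly_nonroot (F : fieldType) (q : {poly F}) :
  infinite_type F -> q != 0 -> exists t, q.[t] != 0.
Proof.
move=> Finf q0.
have [s us ss] : exists2 s : seq F, uniq s & size s = size q.
  elim: (size q) => [|k [s us <-]]; first by exists [::].
  by have [x xs] := Finf s; exists (x :: s); rewrite //= xs us.
have [/(max_poly_roots q0)/(_ us)|] := boolP (all (root q) s).
  by rewrite ss ltnn.
by case/allPn=> t _ qt; exists t.
Qed.

Lemma zariski_open_GL_meet (F : fieldType) (n : nat) (U V : 'M[F]_n -> Prop) :
    infinite_type F -> zariski_open_GL U -> zariski_open_GL V ->
    (exists A, U A) -> (exists A, V A) ->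
  exists A, U A /\ V A.
Proof.
move=> Finf [S US] [T VT] [A UA] [B VB].
have /US[Au [f Sf fA]] := UA; have /VT[_ [h Th hB]] := VB.
have eval_line (e : {mpoly F[n * n]}) t :
    e.@[fun k => mxvec A 0 k + t * mxvec (B - A) 0 k] =
    e.@[fun k => mxvec (A + t *: (B - A)) 0 k].
  by apply: meval_eq => k; case/mxvec_indexP: k => i j; rewrite !mxvecE !mxE.
have [qf qfE] := meval_line f (mxvec A 0) (mxvec (B - A) 0).
have [qh qhE] := meval_line h (mxvec A 0) (mxvec (B - A) 0).
have [qd qdE] := det_line A (B - A).
have nz (q : {poly F}) t : q.[t] != 0 -> q != 0.
  by apply: contraNneq => ->; rewrite horner0.
have qf0 : qf != 0.
  by apply: (nz _ 0); rewrite qfE eval_line scale0r addr0.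
have qh0 : qh != 0.
  by apply: (nz _ 1); rewrite qhE eval_line scale1r addrC subrK.
have qd0 : qd != 0.
  apply: (nz _ 0); rewrite qdE scale0r addr0.
  by rewrite -unitfE -unitmxE.
have [t] := infinite_poly_nonroot Finf (mulf_neq0 qd0 (mulf_neq0 qf0 qh0)).
rewrite !hornerM !mulf_eq0 !negb_or qdE qfE qhE !eval_line => /and3P[du ft ht].
have Cu : A + t *: (B - A) \in unitmx by rewrite unitmxE unitfE.
by exists (A + t *: (B - A)); split; [apply/US | apply/VT];
  split=> //; [exists f | exists h].
Qed.

Lemma is_gin_unique (F : fieldType) (n : nat) (mo : rel 'X_{1..n})
    (I J1 J2 : {mpoly F[n]} -> Prop) :
    infinite_type F -> is_gin mo I J1 -> is_gin mo I J2 ->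
  forall f, J1 f <-> J2 f.
Proof.
move=> Finf [U [Uo Un UJ]] [V [Vo Vn VJ]] f.
have [A [UA VA]] := zariski_open_GL_meet Finf Uo Vo Un Vn.
by rewrite -(UJ A UA f) (VJ A VA f).
Qed.

(* Main.v *)
Require Import Defs.
From HB Require Import structures.
From mathcomp Require Import all_boot all_order all_algebra all_fingroup.
From mathcomp Require Import cyclic mxrepresentation mpoly.
From mathcomp Require Import ring.

(* A generic matrix factors as A = B C, where B is lower triangular, so that
   the substitution B only adds smaller variables to a multiple of each
   variable and preserves all initial monomials, and where C is upper
   triangular.  The stabiliser of H = H(V_5) among the upper triangular
   matrices is large: modulo x_1 the only obstruction is the quadric
   x_3^2 - 2 x_2 x_4 - x_2 x_3, whose image under C has the same shape with
   other coefficients of x_2 x_4 and x_2 x_3, and a diagonal matrix restores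
   these coefficients as soon as the one of x_2 x_3 is nonzero.  Moving that
   diagonal matrix from B to C gives A(H) = B(H), hence In(A(H)) = In(H) for
   every monomial order, without computing either initial ideal. *)

Set Implicit Arguments.
Unset Strict Implicit.
Unset Printing Implicit Defensive.

Import GRing.Theory.
Local Open Scope ring_scope.


(** * Ideals given by generators, and congruences modulo them *)

Lemma ideal_gen_mem (R : comNzRingType) (S : R -> Prop) f : S f -> ideal_gen S f.
Proof.
move=> Sf; exists [:: (1, f)]; last by rewrite big_seq1 mul1r.
by move=> c; rewrite inE => /eqP->.
Qed.

Lemma ideal_genD (R : comNzRingType) (S : R -> Prop) f g :
  ideal_gen S f -> ideal_gen S g -> ideal_gen S (f + g).
Proof.
move=> [s Ss ->] [t St ->]; exists (s ++ t); last by rewrite big_cat.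
by move=> c; rewrite mem_cat => /orP[/Ss|/St].
Qed.

Lemma ideal_genMl (R : comNzRingType) (S : R -> Prop) a f :
  ideal_gen S f -> ideal_gen S (a * f).
Proof.
move=> [s Ss ->]; exists [seq (a * c.1, c.2) | c <- s].
  by move=> _ /mapP[c /Ss Sc ->].
by rewrite big_map mulr_sumr; apply: eq_bigr => c _ /=; rewrite mulrA.
Qed.

Lemma ideal_gen0 (R : comNzRingType) (S : R -> Prop) : ideal_gen S 0.
Proof. by exists [::]; rewrite ?big_nil. Qed.

Lemma ideal_gen_sum (R : comNzRingType) (S : R -> Prop) (T : eqType) (r : seq T)
    (f : T -> R) :
  (forall i, i \in r -> ideal_gen S (f i)) -> ideal_gen S (\sum_(i <- r) f i).
Proof.
move=> Sf; rewrite big_seq; apply: (big_ind (ideal_gen S)) Sf => [|f1 f2].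
  exact: ideal_gen0.
exact: ideal_genD.
Qed.

Lemma ideal_gen_rmorph (R R' : comNzRingType) (S : R -> Prop) (S' : R' -> Prop)
    (phi : {rmorphism R -> R'}) :
    (forall f, S f -> ideal_gen S' (phi f)) ->
  forall f, ideal_gen S f -> ideal_gen S' (phi f).
Proof.
move=> phiS _ [s Ss ->]; rewrite rmorph_sum; apply: ideal_gen_sum => c /Ss Sc.
by rewrite rmorphM; apply/ideal_genMl/phiS.
Qed.

Definition congr_mod (R : comNzRingType) (S : R -> Prop) f g :=
  ideal_gen S (f - g).

Lemma congr_mod_refl (R : comNzRingType) (S : R -> Prop) f : congr_mod S f f.
Proof. by rewrite /congr_mod subrr; apply: ideal_gen0. Qed.

Lemma congr_modD (R : comNzRingType) (S : R -> Prop) f f' g g' :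
  congr_mod S f f' -> congr_mod S g g' -> congr_mod S (f + g) (f' + g').
Proof.
rewrite /congr_mod => Sf Sg.
by rewrite (_ : _ - _ = f - f' + (g - g')); [apply: ideal_genD | ring].
Qed.

Lemma congr_modM (R : comNzRingType) (S : R -> Prop) f f' g g' :
  congr_mod S f f' -> congr_mod S g g' -> congr_mod S (f * g) (f' * g').
Proof.
rewrite /congr_mod => Sf Sg.
rewrite (_ : _ - _ = g * (f - f') + f' * (g - g')); last by ring.
by apply: ideal_genD; apply: ideal_genMl.
Qed.

Lemma congr_modN (R : comNzRingType) (S : R -> Prop) f f' :
  congr_mod S f f' -> congr_mod S (- f) (- f').
Proof.
rewrite /congr_mod => Sf.
by rewrite (_ : _ - _ = -1 * (f - f')); [apply: ideal_genMl | ring].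
Qed.

Lemma congr_modX (R : comNzRingType) (S : R -> Prop) f f' k :
  congr_mod S f f' -> congr_mod S (f ^+ k) (f' ^+ k).
Proof.
move=> Sf; elim: k => [|k IHk]; first exact: congr_mod_refl.
by rewrite !exprS; apply: congr_modM.
Qed.

Lemma ideal_gen_congr (R : comNzRingType) (S : R -> Prop) f f' :
  congr_mod S f f' -> ideal_gen S f' -> ideal_gen S f.
Proof. by move=> Sff' Sf'; rewrite -(subrK f' f); apply: ideal_genD. Qed.

(** * Ring identities behind the stability of the Hilbert ideal *)

(** The binomial expansion is cut at the cube because it is applied to a [y] whose cube lies in the
    ideal; the exponent [k.+2] keeps every power of [x] in it a natural one. *)
Lemma exprDn_mod3 (R : comNzRingType) (x y : R) k :
  exists t r, (x + y) ^+ k.+2 =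
    x ^+ k.+2 + k.+2%:R * x ^+ k.+1 * y + t * x ^+ k * y ^+ 2 + r * y ^+ 3.
Proof.
elim: k => [|k [t [r IHk]]]; first by exists 1, 0; ring.
exists (t + k.+2%:R), (x * r + t * x ^+ k + y * r).
by rewrite exprS IHk -[in k.+3%:R]natr1 !exprS; ring.
Qed.

(** Multiplying the quadric by [a] leaves [a * b ^+ 2] modulo [a ^+ 2]; multiplying it by [b] then
    leaves [b ^+ 3]. With [a ^+ 2] this puts every cubic form in [a] and [b] into the ideal. *)
Lemma hilbert_ideal_cubic (R : comNzRingType) (S : R -> Prop) (a b c : R) :
    ideal_gen S (a ^+ 2) -> ideal_gen S (b ^+ 2 - 2%:R * a * c - a * b) ->
    ideal_gen S (a * b * c) ->
  ideal_gen S (a * b ^+ 2) /\ ideal_gen S (b ^+ 3).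
Proof.
set q := _ - a * b => Ia2 Iq Iabc.
have Iab2 : ideal_gen S (a * b ^+ 2).
  have -> : a * b ^+ 2 = a * q + (2%:R * c + b) * a ^+ 2 by rewrite /q; ring.
  by do ?apply: ideal_genD; apply: ideal_genMl.
split=> //.
have -> : b ^+ 3 = b * q + 2%:R * (a * b * c) + 1 * (a * b ^+ 2).
  by rewrite /q; ring.
by do ?apply: ideal_genD; apply: ideal_genMl.
Qed.

(* [a], [b], [c] stand for x_2, x_3, x_4 modulo x_1, and [k] for p - 7.  The
   two equations make the quadric a multiple of itself modulo [a ^+ 2]. *)
Lemma hilbert_ideal_borel (R : comNzRingType) (S : R -> Prop) (a b c : R) k
    (l m n u v w : R) :
    m ^+ 2 = l * n ->
    2%:R * m * u - 2%:R * l * v - l * m = - m ^+ 2 ->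
  let q a b c := b ^+ 2 - 2%:R * a * c - a * b in
    ideal_gen S (a ^+ 2) -> ideal_gen S (q a b c) ->
    ideal_gen S (a * b * c) -> ideal_gen S (a * c ^+ k.+3) ->
    ideal_gen S (b * c ^+ k.+4) -> ideal_gen S (c ^+ k.+4.+2) ->
  let a' := l * a in let b' := m * b + u * a in
  let c' := n * c + (v * b + w * a) in
  [/\ ideal_gen S (a' ^+ 2), ideal_gen S (q a' b' c'),
      ideal_gen S (a' * b' * c') &
  [/\ ideal_gen S (a' * c' ^+ k.+3), ideal_gen S (b' * c' ^+ k.+4)
    & ideal_gen S (c' ^+ k.+4.+2)]].
Proof.
move=> Emm Euv q Ia2 Iq Iabc Iac Ibc Ic a' b' c'.
have [Iab2 Ib3] := hilbert_ideal_cubic Ia2 Iq Iabc.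
(* With [b ^+ 2] one power of [c] fewer suffices than with [b]: the quadric trades [b ^+ 2] for
   [2 a c + a b]. *)
have Ib2c : ideal_gen S (b ^+ 2 * c ^+ k.+3).
  have -> : b ^+ 2 * c ^+ k.+3 =
      c ^+ k.+3 * q a b c + 2%:R * c * (a * c ^+ k.+3) + c ^+ k.+2 * (a * b * c).
    by rewrite /q !exprS; ring.
  by do ?apply: ideal_genD; apply: ideal_genMl.
set y := v * b + w * a in c' *; set x := n * c in c' *.
have Iy3 : ideal_gen S (y ^+ 3).
  have -> : y ^+ 3 = v ^+ 3 * b ^+ 3 + (3%:R * v ^+ 2 * w) * (a * b ^+ 2) +
     (3%:R * v * w ^+ 2 * b + w ^+ 3 * a) * a ^+ 2 by rewrite /y; ring.
  by do ?apply: ideal_genD; apply: ideal_genMl.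
(* Stated for [a] instead of [a'], since it is used again for the summand [u * a] of [b']. *)
have Iac' : ideal_gen S (a * c' ^+ k.+3).
  have [t [r ->]] := exprDn_mod3 x y k.+1.
  set K := _%:R.
  have -> : a * (x ^+ k.+3 + K * x ^+ k.+2 * y + t * x ^+ k.+1 * y ^+ 2
                  + r * y ^+ 3) =
     n ^+ k.+3 * (a * c ^+ k.+3) + (a * r) * y ^+ 3
     + (K * x ^+ k.+1 * n * v) * (a * b * c)
     + (t * x ^+ k.+1 * v ^+ 2) * (a * b ^+ 2)
     + (K * x ^+ k.+1 * n * c * w + t * x ^+ k.+1 *
        (2%:R * v * w * b + w ^+ 2 * a)) * a ^+ 2.
    by rewrite /x /y !exprMn !exprS; ring.
  by do ?apply: ideal_genD; apply: ideal_genMl.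
split; last split.
- by rewrite exprMn; apply: ideal_genMl.
- have -> : q a' b' c' = m ^+ 2 * q a b c
     + (2%:R * (m ^+ 2 - l * n)) * (a * c)
     + (2%:R * m * u - 2%:R * l * v - l * m + m ^+ 2) * (a * b)
     + (u ^+ 2 - 2%:R * l * w - l * u) * a ^+ 2.
    by rewrite /q /a' /b' /c' /x /y; ring.
  rewrite Euv Emm subrr addNr mulr0 !mul0r !addr0.
  by do ?apply: ideal_genD; apply: ideal_genMl.
- have -> : a' * b' * c' = (l * m * n) * (a * b * c) +
      (l * m * v) * (a * b ^+ 2) + (l * m * w * b + l * u * c') * a ^+ 2.
    by rewrite /a' /b' /c' /x /y; ring.
  by do ?apply: ideal_genD; apply: ideal_genMl.
- by rewrite -mulrA; apply: ideal_genMl.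
- rewrite /b' mulrDl [in X in _ + X]exprS.
  have [t [r ->]] := exprDn_mod3 x y k.+2.
  set K := _%:R.
  have -> : m * b * (x ^+ k.+4 + K * x ^+ k.+3 * y + t * x ^+ k.+2 * y ^+ 2
                  + r * y ^+ 3) + u * a * (c' * c' ^+ k.+3) =
     (m * n ^+ k.+4) * (b * c ^+ k.+4) + (m * b * r) * y ^+ 3
     + (m * K * n ^+ k.+3 * v) * (b ^+ 2 * c ^+ k.+3)
     + (m * K * n ^+ k.+3 * w * c ^+ k.+2) * (a * b * c)
     + (m * t * x ^+ k.+2 * v ^+ 2) * b ^+ 3
     + (m * t * x ^+ k.+2 * 2%:R * v * w) * (a * b ^+ 2)
     + (m * t * x ^+ k.+2 * b * w ^+ 2) * a ^+ 2
     + (u * c') * (a * c' ^+ k.+3).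
    (* The power of [c'] stays opaque: it occurs unchanged in the last term on both sides and must
       not be expanded. *)
    by generalize (c' ^+ k.+3) => z; rewrite /c' /x /y !exprMn !exprS; ring.
  by do ?apply: ideal_genD; apply: ideal_genMl.
- have [t [r ->]] := exprDn_mod3 x y k.+4.
  set K := _%:R.
  have -> : x ^+ k.+4.+2 + K * x ^+ k.+4.+1 * y + t * x ^+ k.+4 * y ^+ 2
                  + r * y ^+ 3 =
     n ^+ k.+4.+2 * c ^+ k.+4.+2 + r * y ^+ 3
     + (K * n ^+ k.+4.+1 * v * c) * (b * c ^+ k.+4)
     + (K * n ^+ k.+4.+1 * w * c ^+ 2) * (a * c ^+ k.+3)
     + (t * n ^+ k.+4 * v ^+ 2 * c) * (b ^+ 2 * c ^+ k.+3)
     + (t * x ^+ k.+3 * n * 2%:R * v * w) * (a * b * c)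
     + (t * x ^+ k.+4 * w ^+ 2) * a ^+ 2.
    by rewrite /x /y !exprMn !exprS; ring.
  by do ?apply: ideal_genD; apply: ideal_genMl.
Qed.


(** * Linear substitutions and their action on the generators *)

HB.instance Definition _ (F : fieldType) n (A : 'M[F]_n) :=
  GRing.LRMorphism.copy (lin_subst A)
    (comp_mpoly [tuple \sum_(i < n) A i j *: 'X_i | j < n]).

Lemma lin_substX (F : fieldType) n (A : 'M[F]_n) j :
  lin_subst A 'X_j = \sum_(i < n) A i j *: 'X_i.
Proof. by rewrite /lin_subst comp_mpolyXU -tnth_nth tnth_mktuple. Qed.

Lemma lin_substXm (F : fieldType) n (A : 'M[F]_n) (m : 'X_{1..n}) :
  lin_subst A 'X_[m] = \prod_(j < n) (\sum_(i < n) A i j *: 'X_i) ^+ m j.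
Proof.
rewrite /lin_subst comp_mpolyX; apply: eq_bigr => j _.
by rewrite tnth_mktuple.
Qed.

(** Both sides send a row vector [v] to [f (v *m A *m B)]. Hence for a factorisation [B *m C] the
    substitution [C] acts first on the ideal. *)
Lemma lin_substM (F : fieldType) n (A B : 'M[F]_n) f :
  lin_subst (A *m B) f = lin_subst A (lin_subst B f).
Proof.
rewrite (mpolyE f) [LHS]raddf_sum [lin_subst B _]raddf_sum [RHS]raddf_sum.
apply: eq_bigr => m _ /=.
rewrite !linearZ /=; congr (_ *: _).
rewrite !lin_substXm rmorph_prod.
apply: eq_bigr => j _; rewrite rmorphXn raddf_sum /=; congr (_ ^+ _).
under eq_bigr do rewrite mxE scaler_suml.
rewrite exchange_big; apply: eq_bigr => i _ /=.
rewrite linearZ /= lin_substX scaler_sumr.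
by apply: eq_bigr => k _; rewrite scalerA mulrC.
Qed.

(** An upper triangular [C] sends each variable to itself and earlier ones. Modulo [x 0] the
    generators in the three middle variables are covered by [hilbert_ideal_borel], with [l], [m],
    [n] on the diagonal of [C] and [u], [v], [w] above it; the power of the last variable is covered
    by Frobenius. *)
Lemma hilbert_gens_V5_borel (F : fieldType) p (C : 'M[F]_5) :
    prime p -> (5 < p)%N -> p \in [pchar F] -> is_trig_mx C^T ->
    let c i j := C (inord i) (inord j) in
    c 2 2 ^+ 2 = c 1 1 * c 3 3 ->
    2%:R * c 2 2 * c 1 2 - 2%:R * c 1 1 * c 2 3 - c 1 1 * c 2 2
      = - c 2 2 ^+ 2 ->
  forall f, ideal_gen (fun h => h \in hilbert_gens_V5 F p) f ->
            ideal_gen (fun h => h \in hilbert_gens_V5 F p) (lin_subst C f).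
Proof.
move=> p_pr p_gt5 pF /is_trig_mxP Cup c Ed Eo.
(* Primality excludes [6], so [p - 4], [p - 3] and [p - 1] become [k.+3], [k.+4] and [k.+4.+2]. *)
have [k Dp] : exists k, p = k.+4.+3.
  by case: p p_pr p_gt5 {pF} => [|[|[|[|[|[|[|k]]]]]]] //; exists k.
have pR : p \in [pchar {mpoly F[5]}] by apply: (rmorph_pchar (@mpolyC 5 F)).
set S := fun h => h \in hilbert_gens_V5 F p.
have c0 i j : (j < i < 5)%N -> c i j = 0.
  case/andP=> ji i5; have := Cup (inord j) (inord i).
  by rewrite mxE; apply; rewrite !inordK // (ltn_trans ji).
pose x i : {mpoly F[5]} := 'X_(inord i).
have Sgen i : (i < 8)%N -> ideal_gen S (hilbert_gens_V5 F p)`_i.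
  by move=> i8; apply/ideal_gen_mem/mem_nth.
have I1 : ideal_gen S (x 0) := Sgen 0 isT.
have Ia := Sgen 1 isT; have Iq := Sgen 2 isT; have Iabc := Sgen 3 isT.
have Iac : ideal_gen S (x 1 * x 3 ^+ k.+3).
  by have := Sgen 4 isT; rewrite /= Dp.
have Ibc : ideal_gen S (x 2 * x 3 ^+ k.+4).
  by have := Sgen 5 isT; rewrite /= Dp.
have Ic : ideal_gen S (x 3 ^+ k.+4.+2).
  by have := Sgen 6 isT; rewrite /= Dp.
have Ex i : (i < 5)%N -> lin_subst C (x i) = \sum_(j < i.+1) (c j i)%:MP * x j.
  move=> i5; rewrite lin_substX.
  rewrite [RHS](big_ord_widen_cond _ xpredT (fun j => (c j i)%:MP * x j) i5).
  rewrite [RHS]big_mkcond /=; apply: eq_bigr => j _.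
  rewrite ltnS leqNgt; case: ifP => [_|/negbFE ij].
    by rewrite mul_mpolyC /c /x inord_val.
  by rewrite -(inord_val j) -/(c _ _) c0 ?scale0r // ij ltn_ord.
have Emm : (c 2 2)%:MP ^+ 2 = (c 1 1)%:MP * (c 3 3)%:MP :> {mpoly F[5]}.
  by rewrite -rmorphXn Ed rmorphM.
have Euv : 2%:R * (c 2 2)%:MP * (c 1 2)%:MP - 2%:R * (c 1 1)%:MP * (c 2 3)%:MP
    - (c 1 1)%:MP * (c 2 2)%:MP = - (c 2 2)%:MP ^+ 2 :> {mpoly F[5]}.
  rewrite -(rmorph_nat (@mpolyC 5 F)) -rmorphXn -!rmorphM -!rmorphB -rmorphN.
  by rewrite Eo.
have [Ja Jq Jabc [Jac Jbc Jc]] :=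
  hilbert_ideal_borel (c 1 3)%:MP Emm Euv Ia Iq Iabc Iac Ibc Ic.
have cong1 f g r : f = r * x 0 + g -> congr_mod S f g.
  by move=> ->; rewrite /congr_mod addrK; apply: ideal_genMl.
have Ca : congr_mod S (lin_subst C (x 1)) ((c 1 1)%:MP * x 1).
  by apply: (cong1 _ _ (c 0 1)%:MP); rewrite Ex // !big_ord_recr big_ord0 /= add0r.
have Cb : congr_mod S (lin_subst C (x 2))
                      ((c 2 2)%:MP * x 2 + (c 1 2)%:MP * x 1).
  apply: (cong1 _ _ (c 0 2)%:MP); rewrite Ex // !big_ord_recr big_ord0 /= add0r.
  by ring.
have Cc : congr_mod S (lin_subst C (x 3))
   ((c 3 3)%:MP * x 3 + ((c 2 3)%:MP * x 2 + (c 1 3)%:MP * x 1)).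
  apply: (cong1 _ _ (c 0 3)%:MP); rewrite Ex // !big_ord_recr big_ord0 /= add0r.
  by ring.
have C2 : congr_mod S 2%:R 2%:R by apply: congr_mod_refl.
have [_ Ib3] := hilbert_ideal_cubic Ia Iq Iabc.
(* All five powers are needed: the image of the last variable may involve every variable. *)
have Ixp : forall j, (j < 5)%N -> ideal_gen S (x j ^+ p).
  case=> [|[|[|[|[|j]]]]] // _; rewrite ?Dp.
  - by rewrite exprSr; apply: ideal_genMl.
  - by rewrite -(addn2 k.+4.+1) exprD; apply: ideal_genMl.
  - by rewrite -(addn3 k.+4) exprD; apply: ideal_genMl.
  - by rewrite exprS; exact: ideal_genMl Ic.
  - by have := Sgen 7 isT; rewrite /= Dp.
have Sgens : forall i, (i < 8)%N ->
    ideal_gen S (lin_subst C (hilbert_gens_V5 F p)`_i).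
  case=> [|[|[|[|[|[|[|[|i]]]]]]]] // _ /=; rewrite ?rmorphXn.
  - by rewrite Ex // big_ord1; apply: ideal_genMl.
  - by apply: ideal_gen_congr Ja; apply: congr_modX.
  - rewrite !rmorphB rmorphXn !rmorphM rmorph_nat; apply: ideal_gen_congr Jq.
    apply: congr_modD; last by apply/congr_modN/congr_modM.
    apply: congr_modD; first exact: congr_modX.
    by apply/congr_modN/congr_modM => //; apply: congr_modM.
  - rewrite !rmorphM; apply: ideal_gen_congr Jabc.
    by apply: congr_modM => //; apply: congr_modM.
  - rewrite rmorphM rmorphXn Dp; apply: ideal_gen_congr Jac.
    by apply: congr_modM => //; apply: congr_modX.
  - rewrite rmorphM rmorphXn Dp; apply: ideal_gen_congr Jbc.
    by apply: congr_modM => //; apply: congr_modX.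
  - by rewrite Dp; apply: ideal_gen_congr Jc; apply: congr_modX.
  (* In characteristic [p] the [p]-th power of a sum is the sum of the [p]-th powers. *)
  - rewrite /= Ex // -(pFrobenius_autE pR) rmorph_sum.
    apply: ideal_gen_sum => j _; rewrite rmorphM /= !pFrobenius_autE.
    exact/ideal_genMl/Ixp.
apply: ideal_gen_rmorph => h Sh; have := Sgens (index h (hilbert_gens_V5 F p)).
by rewrite nth_index //; apply; rewrite index_mem.
Qed.


(** * Initial monomials under lower triangular substitutions *)

(* The coefficient [c] may vanish, so [m] only bounds the initial monomial. *)
Definition lead_bound (F : fieldType) n (mo : rel 'X_{1..n}) (f : {mpoly F[n]})
    (m : 'X_{1..n}) (c : F) : Prop :=
  f@_m = c /\ (forall k, k \in msupp f -> mo k m).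

Lemma mcoeff_sum_msupp (F : fieldType) n (f : {mpoly F[n]}) m :
  f@_m = \sum_(k <- msupp f) f@_k * (k == m)%:R.
Proof.
rewrite [in LHS](mpolyE f) raddf_sum /=; apply: eq_bigr => k _.
by rewrite mcoeffZ mcoeffX.
Qed.

(** From [k + l = m + m'] follows [k + l <= k + m' <= m + m' = k + l], which forces equality. So
    only one pair of terms contributes to the top coefficient of a product. *)
Lemma monomial_order_add_eq n (mo : rel 'X_{1..n}) (k l m m' : 'X_{1..n}) :
    monomial_order mo -> mo k m -> mo l m' ->
  ((k + l)%MM == (m + m')%MM) = (k == m) && (l == m').
Proof.
move=> mo_ord km lm'; apply/eqP/andP => [Ekl|[/eqP-> /eqP-> //]].
have Elm : l = m'.
  apply: (@addmI _ k); apply: (mo_anti mo_ord); rewrite mo_add // Ekl.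
  by rewrite addmC [X in mo _ X]addmC mo_add.
by move: Ekl; rewrite Elm => /addIm->.
Qed.

Lemma lead_boundM (F : fieldType) n (mo : rel 'X_{1..n}) (f g : {mpoly F[n]})
    m m' c d :
    monomial_order mo -> lead_bound mo f m c -> lead_bound mo g m' d ->
  lead_bound mo (f * g) (m + m')%MM (c * d).
Proof.
move=> mo_ord [<- fm] [<- gm]; split; last first.
  move=> _ /msuppM_le/allpairsP[[k l] /= [/fm km /gm lm ->]].
  apply: (mo_trans mo_ord) (mo_add mo_ord m lm).
  by rewrite addmC [X in mo _ X]addmC mo_add.
rewrite [in LHS](mpolyE f) [in LHS](mpolyE g) mulr_suml raddf_sum /=.
rewrite (mcoeff_sum_msupp f) mulr_suml big_seq [RHS]big_seq.
apply: eq_bigr => k /fm km; rewrite mulr_sumr raddf_sum /=.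
rewrite (mcoeff_sum_msupp g) mulr_sumr big_seq [RHS]big_seq.
apply: eq_bigr => l /gm lm.
rewrite -scalerAl -scalerAr scalerA -mpolyXD mcoeffZ mcoeffX.
by rewrite (monomial_order_add_eq mo_ord km lm) -mulnb natrM; ring.
Qed.

Lemma lead_bound1 (F : fieldType) n (mo : rel 'X_{1..n}) :
  monomial_order mo -> lead_bound mo (1 : {mpoly F[n]}) 0%MM 1.
Proof.
move=> mo_ord; split=> [|k]; first by rewrite mcoeff1 eqxx.
by rewrite msupp1 inE => /eqP->; apply: mo_refl.
Qed.

Lemma lead_boundX (F : fieldType) n (mo : rel 'X_{1..n}) (f : {mpoly F[n]})
    m c k :
    monomial_order mo -> lead_bound mo f m c ->
  lead_bound mo (f ^+ k) (m *+ k)%MM (c ^+ k).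
Proof.
move=> mo_ord fm; elim: k => [|k IHk].
  by rewrite mulm0n; apply: lead_bound1.
by rewrite !exprS mulmS; apply: lead_boundM.
Qed.

Lemma lead_bound_prod (F : fieldType) n (mo : rel 'X_{1..n}) (T : Type)
    (r : seq T) (f : T -> {mpoly F[n]}) m c :
    monomial_order mo -> (forall i, lead_bound mo (f i) (m i) (c i)) ->
  lead_bound mo (\prod_(i <- r) f i) (\sum_(i <- r) m i)%MM (\prod_(i <- r) c i).
Proof.
move=> mo_ord fm; elim: r => [|i r IHr].
  by rewrite !big_nil; apply: lead_bound1.
by rewrite !big_cons; apply: lead_boundM.
Qed.

(** A lower triangular [B] sends ['X_j] to [B j j *: 'X_j] plus later, hence smaller, variables;
    leading terms multiply. *)
Lemma lead_bound_lin_subst_mono (F : fieldType) n (mo : rel 'X_{1..n})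
    (B : 'M[F]_n) (m : 'X_{1..n}) :
    monomial_order mo ->
    (forall i j : 'I_n, (i < j)%N -> mo U_(j)%MM U_(i)%MM) ->
    is_trig_mx B ->
  lead_bound mo (lin_subst B 'X_[m]) m (\prod_(j < n) B j j ^+ m j).
Proof.
move=> mo_ord mo_var /is_trig_mxP Btrig.
rewrite lin_substXm [m in lead_bound _ _ m _]multinomUE_id.
apply: lead_bound_prod => // j; apply: lead_boundX => //.
have coefE k : (\sum_(i < n) B i j *: 'X_i : {mpoly F[n]})@_k
                 = \sum_(i < n) B i j * (U_(i)%MM == k)%:R.
  by rewrite raddf_sum /=; apply: eq_bigr => i _; rewrite mcoeffZ mcoeffX.
split=> [|k].
  rewrite coefE (bigD1 j) //= eqxx mulr1 big1 ?addr0 // => i /negPf ij.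
  by rewrite eq_mnm1 ij mulr0.
rewrite mcoeff_msupp coefE => /eqP nz.
have [i] : exists i, B i j * (U_(i)%MM == k)%:R != 0.
  apply/existsP; apply: contra_notT nz => /existsPn Z.
  by apply: big1 => i _; apply/eqP; rewrite -[_ == _]negbK; apply: Z.
rewrite mulf_eq0 negb_or => /andP[Bij].
have [<- _|] := eqVneq U_(i)%MM k; last by rewrite eqxx.
have [ij|ji|/val_inj->] := ltngtP i j; last exact: mo_refl.
  by rewrite Btrig ?eqxx in Bij.
exact: mo_var.
Qed.

Lemma is_initial_lin_subst (F : fieldType) n (mo : rel 'X_{1..n})
    (B : 'M[F]_n) f m :
    monomial_order mo ->
    (forall i j : 'I_n, (i < j)%N -> mo U_(j)%MM U_(i)%MM) ->
    is_trig_mx B -> (forall j, B j j != 0) ->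
  is_initial mo f m -> is_initial mo (lin_subst B f) m.
Proof.
move=> mo_ord mo_var Btrig Bnz [mf fm].
have lead k := lead_bound_lin_subst_mono k mo_ord mo_var Btrig.
have BfE : lin_subst B f = \sum_(k <- msupp f) f@_k *: lin_subst B 'X_[k].
  by rewrite [in LHS](mpolyE f) raddf_sum; apply: eq_bigr => k _; rewrite /= linearZ.
split; last first.
  move=> k; rewrite BfE => /msupp_sum_le/flattenP[s /mapP[l]].
  rewrite filter_predT => /fm lm -> /msuppZ_le kl.
  by apply: (mo_trans mo_ord) lm; have [_] := lead l; apply.
(* Only [k = m] contributes to the coefficient at [m]: if [m] occurs in the image of ['X_[k]], then
   [m <= k <= m]. *)
rewrite mcoeff_msupp BfE raddf_sum /= (bigD1_seq m) ?msupp_uniq //=.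
rewrite big_seq_cond big1 => [|k /andP[kf km]].
  rewrite addr0 mcoeffZ (lead m).1 mulf_neq0 -?mcoeff_msupp //.
  by apply/prodf_neq0 => j _; apply: expf_neq0.
rewrite mcoeffZ [X in _ * X]memN_msupp_eq0 ?mulr0 //; apply: contra km => mk.
by apply/eqP/(mo_anti mo_ord); rewrite fm // (lead k).2.
Qed.

Lemma is_initial_exists (F : fieldType) n (mo : rel 'X_{1..n}) (f : {mpoly F[n]}) :
  monomial_order mo -> f != 0 -> exists m, is_initial mo f m.
Proof.
move=> mo_ord; rewrite -msupp_eq0 /is_initial; elim: (msupp f) => // k s IHs _.
have [->|/IHs[m [ms sm]]] := eqVneq s [::].
  exists k; rewrite mem_head; split=> // l; rewrite inE => /eqP->.
  exact: mo_refl.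
have [km|mk] := orP (mo_total mo_ord k m); [exists m | exists k].
  by rewrite inE ms orbT; split=> // l; rewrite inE => /predU1P[->|/sm].
rewrite mem_head; split=> // l; rewrite inE => /predU1P[->|/sm lm].
  exact: mo_refl.
exact: (mo_trans mo_ord) lm mk.
Qed.

(** For the converse, [f] is nonzero and has some initial monomial; it is also initial in the image,
    and initial monomials are unique. *)
Lemma is_initial_lin_substE (F : fieldType) n (mo : rel 'X_{1..n})
    (B : 'M[F]_n) f m :
    monomial_order mo ->
    (forall i j : 'I_n, (i < j)%N -> mo U_(j)%MM U_(i)%MM) ->
    is_trig_mx B -> (forall j, B j j != 0) ->
  is_initial mo (lin_subst B f) m <-> is_initial mo f m.
Proof.
move=> mo_ord mo_var Btrig Bnz; split=> [Bfm|]; last exact: is_initial_lin_subst.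
have [f0|/(is_initial_exists mo_ord)[k fk]] := eqVneq f 0.
  by case: Bfm; rewrite f0 raddf0 msupp0.
have [kBf Bfk] := is_initial_lin_subst mo_ord mo_var Btrig Bnz fk.
have [mBf Bfm'] := Bfm.
by rewrite (_ : m = k) //; apply: (mo_anti mo_ord); rewrite Bfk ?Bfm'.
Qed.

Lemma ideal_gen_ext (R : comNzRingType) (S S' : R -> Prop) :
  (forall f, S f <-> S' f) -> forall f, ideal_gen S f <-> ideal_gen S' f.
Proof.
by move=> SS' f; split=> -[s Ss ->]; exists s => // c /Ss/SS'.
Qed.

(** Stability under [C] and its inverse gives [C(I) = I], so the substituted ideal is [B(I)], and
    [B] preserves the initial monomial of each element. *)
Lemma initial_ideal_lower_stab (F : fieldType) n (mo : rel 'X_{1..n})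
    (I : {mpoly F[n]} -> Prop) (B C C' : 'M[F]_n) :
    monomial_order mo ->
    (forall i j : 'I_n, (i < j)%N -> mo U_(j)%MM U_(i)%MM) ->
    is_trig_mx B -> (forall j, B j j != 0) -> C *m C' = 1%:M ->
    (forall f, I f -> I (lin_subst C f)) ->
    (forall f, I f -> I (lin_subst C' f)) ->
  forall g, initial_ideal mo (fun h => exists2 f, I f & h = lin_subst (B *m C) f) g
            <-> initial_ideal mo I g.
Proof.
move=> mo_ord mo_var Btrig Bnz CC' IC IC'; apply: ideal_gen_ext => g.
have BE f m := is_initial_lin_substE f m mo_ord mo_var Btrig Bnz.
split=> [[_ [m [[f If ->]]]]|[f [m [If fm ->]]]].
  by rewrite lin_substM BE => fm ->; exists (lin_subst C f), m; split; auto.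
exists (lin_subst B f), m; split=> //; last exact/BE.
(* The substitution [B *m C] undoes [C'] first and then applies [B]. *)
by exists (lin_subst C' f); rewrite -?lin_substM -?mulmxA ?CC' ?mulmx1 //; auto.
Qed.


(** * Triangular factorisation and the minors that control it *)

(** Induction on the row: in the entry [i j] of [L *m M] with [i < j], earlier rows of [M] vanish by
    induction and later columns of [L] by triangularity, leaving [L i i * M i j = 0]. *)
Lemma trig_mx_rinv (F : fieldType) n (L M : 'M[F]_n) :
  is_trig_mx L -> L *m M = 1%:M -> is_trig_mx M.
Proof.
move=> Ltrig LM; have Lnz i : L i i != 0.
  have : \det L != 0.
    apply/eqP => L0; have /eqP := congr1 determinant LM.
    by rewrite det_mulmx L0 mul0r det1 eq_sym oner_eq0.
  by rewrite det_trig // => /prodf_neq0; apply.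
apply/is_trig_mxP => i j; have [k] := ubnP (i : nat).
elim: k i => // k IHk i ik ij; have := congr1 (fun N : 'M_n => N i j) LM.
rewrite !mxE (bigD1 i) //= big1 => [|l li].
  rewrite addr0 -val_eqE ltn_eqF // => /eqP.
  by rewrite mulf_eq0 (negPf (Lnz i)) => /eqP.
have [il|li'|/val_inj li'] := ltngtP i l; last by rewrite li' eqxx in li.
  by move/is_trig_mxP: Ltrig => ->; rewrite ?mul0r.
by rewrite (IHk l) ?mulr0 //; [apply: leq_trans li' _ | apply: ltn_trans ij].
Qed.

(** Induction by bordering: the upper left block factors with invertible factors, which determine
    the border, and the Schur complement becomes the last pivot of [L]. *)
Lemma lu_decomposition (F : fieldType) n (A : 'M[F]_n) :
    (forall k (kn : (k <= n)%N),
       \det (mxsub (widen_ord kn) (widen_ord kn) A) != 0) ->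
  exists L U : 'M[F]_n,
    [/\ A = L *m U, is_trig_mx L, is_trig_mx U^T & forall i, U i i = 1].
Proof.
elim: n A => [|n IHn] A.
  by exists 0, 0; split; rewrite ?thinmx0 ?mx0_is_trig // => -[].
move: A; rewrite -addn1 => A minA.
pose A1 := ulsubmx A.
have minA1 k (kn : (k <= n)%N) :
    \det (mxsub (widen_ord kn) (widen_ord kn) A1) != 0.
  rewrite (_ : mxsub _ _ _ = let kn' := leq_trans kn (leq_addr 1 n) in
             mxsub (widen_ord kn') (widen_ord kn') A); first exact: minA.
  by apply/matrixP => i j; rewrite !mxE; congr (A _ _); apply: val_inj.
have [L [U [DA1 Ltrig Utrig U1]]] := IHn _ minA1.
have : \det A1 != 0.
  rewrite (_ : A1 = mxsub (widen_ord (leqnn n)) (widen_ord (leqnn n)) A1) //.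
  by apply/matrixP => i j; rewrite !mxE; congr (A _ _); apply: val_inj.
rewrite DA1 det_mulmx mulf_eq0 negb_or -!unitfE -!unitmxE => /andP[Lu Uu].
pose q := invmx L *m ursubmx A; pose r := dlsubmx A *m invmx U.
exists (block_mx L 0 r (drsubmx A - r *m q)), (block_mx U q 0 1%:M).
split.
- rewrite mulmx_block !mul0mx !mulmx0 !mulmx1 !addr0 mulKVmx // mulmxKV //.
  by rewrite [r *m q + _]addrC subrK -DA1 submxK.
- by rewrite is_trig_block_mx // eqxx Ltrig mx11_is_trig.
- by rewrite tr_block_mx is_trig_block_mx // trmx0 eqxx Utrig mx11_is_trig.
move=> i; case: (split_ordP i) => j ->.
  by rewrite block_mxEul U1.
by rewrite block_mxEdr mxE eqxx.
Qed.

(** The first [k] rows of [L] live in the first [k] columns, so the Cauchy-Binet sum for these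
    minors of [L *m U] has a single term. *)
Lemma mxsub_mul_trig (F : fieldType) n k (kn : (k <= n)%N) (L U : 'M[F]_n)
    (g : 'I_k -> 'I_n) (w := widen_ord kn) :
  is_trig_mx L -> mxsub w g (L *m U) = mxsub w w L *m mxsub w g U.
Proof.
move=> /is_trig_mxP Ltrig; apply/matrixP => i j; rewrite !mxE.
under [RHS]eq_bigr do rewrite !mxE.
rewrite (bigID (fun l : 'I_n => (l < k)%N)) /= [X in _ + X]big1 ?addr0.
  rewrite (reindex w) /=; first by apply: eq_bigl => l; rewrite /= ltn_ord.
  exists (fun l => insubd i l) => l; last rewrite inE => lk.
    by rewrite inE => _; apply: val_inj; rewrite val_insubd /= ltn_ord.
  by apply: val_inj; rewrite /= val_insubd lk.
move=> l; rewrite -leqNgt => kl.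
by rewrite Ltrig ?mul0r //; apply: leq_trans kl => /=; apply: ltn_ord.
Qed.

Lemma det_leading_trig (F : fieldType) n k (kn : (k <= n)%N) (L : 'M[F]_n)
    (w := widen_ord kn) :
  is_trig_mx L -> \det (mxsub w w L) = \prod_(i < k) L (w i) (w i).
Proof.
move=> /is_trig_mxP Ltrig; rewrite det_trig.
  by apply: eq_bigr => i _; rewrite mxE.
by apply/is_trig_mxP => i j ij; rewrite mxE Ltrig.
Qed.

(** These are the first [k] columns with the last one moved one step to the right; the corresponding
    minor detects a superdiagonal entry of [U]. *)
Definition skip_col n k (i : 'I_k) : 'I_n.+1 := inord (if i.+1 == k then k else i).

(** The submatrix is still upper triangular, and only its last diagonal entry may differ from
    [1]. *)
Lemma det_skip_unitrig (F : fieldType) n k (kn : (k.+1 <= n.+1)%N)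
    (U : 'M[F]_n.+1) :
    (k.+1 < n.+1)%N -> is_trig_mx U^T -> (forall i, U i i = 1) ->
  \det (mxsub (widen_ord kn) (@skip_col n k.+1) U) = U (inord k) (inord k.+1).
Proof.
move=> kn' /is_trig_mxP Utrig U1; rewrite -det_tr det_trig.
  rewrite big_ord_recr /= big1 ?mul1r => [|i _].
    by rewrite !mxE /skip_col eqxx; congr (U _ _); apply: val_inj; rewrite /= inordK.
  rewrite !mxE /skip_col eqSS ltn_eqF //= -[RHS](U1 (inord i)); congr (U _ _).
  by apply: val_inj; rewrite /= inordK // (leq_trans (ltn_ord i)) // ltnW.
apply/is_trig_mxP => i j ij; have := Utrig (skip_col n i) (widen_ord kn j).
rewrite !mxE; apply; rewrite /skip_col ltn_eqF /=.
  by rewrite inordK // (leq_trans (ltn_ord i)).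
by rewrite ltnS; apply: leq_trans ij _; rewrite -ltnS.
Qed.

(** A minor of the generic matrix, in the coordinates used by [zariski_open_GL]. *)
Definition minor_mpoly (F : fieldType) n k (f g : 'I_k -> 'I_n) : {mpoly F[n * n]} :=
  \det (\matrix_(i, j) 'X_(mxvec_index (f i) (g j))).

Lemma minor_mpolyE (F : fieldType) n k (f g : 'I_k -> 'I_n) (A : 'M[F]_n) :
  (minor_mpoly F f g).@[fun k => mxvec A 0 k] = \det (mxsub f g A).
Proof.
rewrite /minor_mpoly -(det_map_mx (meval _)); congr (\det _).
by apply/matrixP => i j; rewrite !mxE /= mevalXU mxvecE.
Qed.

Definition leading_minor (F : fieldType) n k (kn : (k <= n)%N) :=
  minor_mpoly F (widen_ord kn) (widen_ord kn).

Definition skip_minor (F : fieldType) n k (kn : (k <= n.+1)%N) :=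
  minor_mpoly F (widen_ord kn) (@skip_col n k).

(* If [A = L U] with [U] upper unitriangular, the last factor is
   [1 + 2 U_34 - 2 U_23] times two leading minors, with the paper's indices. *)
Definition borel_locus (F : fieldType) : {mpoly F[5 * 5]} :=
  let m2 := leading_minor F (isT : 2 <= 5)%N in
  let m3 := leading_minor F (isT : 3 <= 5)%N in
  (\prod_(k < 6) leading_minor F (ltn_ord k : (k <= 5)%N)) *
  (m2 * m3 + 2%:R * m2 * skip_minor F (isT : 3 <= 5)%N
   - 2%:R * skip_minor F (isT : 2 <= 5)%N * m3).

Lemma leading_minor_lu (F : fieldType) n k (kn : (k <= n)%N) (L U : 'M[F]_n)
    (w := widen_ord kn) :
    is_trig_mx L -> is_trig_mx U^T -> (forall i, U i i = 1) ->
  (leading_minor F kn).@[fun k => mxvec (L *m U) 0 k] = \prod_(i < k) L (w i) (w i).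
Proof.
move=> Ltrig Utrig U1; rewrite minor_mpolyE mxsub_mul_trig // det_mulmx.
rewrite det_leading_trig // -[X in _ * X]det_tr trmx_mxsub det_leading_trig //.
by rewrite [X in _ * X]big1 ?mulr1 // => i _; rewrite mxE U1.
Qed.

(** Compared with [leading_minor_lu], this expresses a superdiagonal entry of [U] as a quotient of
    two minors of the product, so conditions on [U] become polynomial in the matrix. *)
Lemma skip_minor_lu (F : fieldType) n k (kn : (k.+1 <= n.+1)%N) (L U : 'M[F]_n.+1)
    (w := widen_ord kn) :
    (k.+1 < n.+1)%N ->
    is_trig_mx L -> is_trig_mx U^T -> (forall i, U i i = 1) ->
  (skip_minor F kn).@[fun k => mxvec (L *m U) 0 k] =
    (\prod_(i < k.+1) L (w i) (w i)) * U (inord k) (inord k.+1).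
Proof.
move=> kn' Ltrig Utrig U1; rewrite minor_mpolyE mxsub_mul_trig // det_mulmx.
by rewrite det_leading_trig // det_skip_unitrig.
Qed.

Lemma borel_locus_lu (F : fieldType) (L U : 'M[F]_5) :
    is_trig_mx L -> is_trig_mx U^T -> (forall i, U i i = 1) ->
  let minor k kn := (@leading_minor F 5 k kn).@[fun i => mxvec (L *m U) 0 i] in
  (borel_locus F).@[fun k => mxvec (L *m U) 0 k] =
    (\prod_(k < 6) minor k (ltn_ord k)) * (minor 2 isT * minor 3 isT *
     (1 + 2%:R * U (inord 2) (inord 3) - 2%:R * U (inord 1) (inord 2))).
Proof.
move=> Ltrig Utrig U1 minor.
have E2 := skip_minor_lu (isT : 2 <= 5)%N isT Ltrig Utrig U1.
have E3 := skip_minor_lu (isT : 3 <= 5)%N isT Ltrig Utrig U1.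
have minorE k kn : minor k kn = _ := leading_minor_lu kn Ltrig Utrig U1.
rewrite -minorE in E2; rewrite -minorE in E3.
rewrite mevalM rmorph_prod; congr (_ * _).
rewrite mevalB mevalD !mevalM.
rewrite E2 E3 -/(minor 2 isT) -/(minor 3 isT).
rewrite !rmorph_nat.
ring.
Qed.

Lemma generic_lu (F : fieldType) (A : 'M[F]_5) :
    (borel_locus F).@[fun k => mxvec A 0 k] != 0 ->
  exists L U : 'M[F]_5,
    [/\ A = L *m U, is_trig_mx L, is_trig_mx U^T, forall i, U i i = 1 &
        1 + 2%:R * U (inord 2) (inord 3) - 2%:R * U (inord 1) (inord 2) != 0].
Proof.
move=> PA; have [|L [U [DA Ltrig Utrig U1]]] := @lu_decomposition F 5 A.
  move=> k kn; move: PA; rewrite rmorphM rmorph_prod mulf_eq0 negb_or.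
  case/andP=> /prodf_neq0/(_ (Ordinal (kn : (k < 6)%N)) isT) + _.
  rewrite /= minor_mpolyE; apply: contraNneq => A0; rewrite -[X in _ == X]A0.
  apply/eqP; congr (\det _).
  by apply/matrixP => i j; rewrite !mxE; congr (A _ _); apply: val_inj.
exists L, U; split=> //; move: PA; rewrite DA borel_locus_lu // !mulf_eq0 !negb_or.
by case/and3P.
Qed.

(** Nonemptiness of the open set: for the identity all leading minors are [1] and the superdiagonal
    entries vanish. *)
Lemma borel_locus1 (F : fieldType) :
  (borel_locus F).@[fun k => mxvec (1%:M : 'M[F]_5) 0 k] != 0.
Proof.
have T1 : is_trig_mx (1%:M : 'M[F]_5) by apply: scalar_mx_is_trig.
have D1 i : (1%:M : 'M[F]_5) i i = 1 by rewrite mxE eqxx.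
have T1' : is_trig_mx (1%:M : 'M[F]_5)^T by rewrite trmx1.
have ne i j : (i != j)%N -> (i < 5)%N -> (j < 5)%N ->
    (1%:M : 'M[F]_5) (inord i) (inord j) = 0.
  by move=> ij i5 j5; rewrite mxE -val_eqE /= !inordK // (negPf ij).
have minor1 k kn : (@leading_minor F 5 k kn).@[fun i => mxvec (1%:M *m 1%:M) 0 i] = 1.
  by rewrite leading_minor_lu // big1.
rewrite -[in mxvec _](mulmx1 1%:M) borel_locus_lu // !minor1.
by rewrite !ne // !mulr0 addr0 subr0 !mulr1 big1 ?oner_eq0.
Qed.

(** * The upper triangular stabiliser, and factorisation through it *)

(** The primed letters are entries of the inverse matrix. Solving for them, the defect of the second
    equation for the inverse is the original defect divided by [- l * m ^+ 3]. *)
Lemma borel_condition_inv (F : fieldType) (l m n u v l' m' n' u' v' : F) :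
    l * l' = 1 -> m * m' = 1 -> n * n' = 1 ->
    l * u' + u * m' = 0 -> m * v' + v * n' = 0 ->
    m ^+ 2 = l * n -> 2%:R * m * u - 2%:R * l * v - l * m = - m ^+ 2 ->
  m' ^+ 2 = l' * n' /\ 2%:R * m' * u' - 2%:R * l' * v' - l' * m' = - m' ^+ 2.
Proof.
move=> ll mm nn lu mv E1 E2.
have l0 : l != 0 by apply/eqP => Z; move: ll => /eqP; rewrite Z mul0r eq_sym oner_eq0.
have m0 : m != 0 by apply/eqP => Z; move: mm => /eqP; rewrite Z mul0r eq_sym oner_eq0.
have Dn : n = m ^+ 2 / l by rewrite E1; field.
have Dl' : l' = l^-1 by rewrite -[RHS]mulr1 -ll mulKf.
have Dm' : m' = m^-1 by rewrite -[RHS]mulr1 -mm mulKf.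
have Dn' : n' = l / m ^+ 2.
  rewrite -[RHS]mulr1 -nn Dn; field; exact/andP.
have Du' : u' = - u / (l * m).
  apply: (mulfI l0); rewrite -[LHS]addr0 -(subrr (u * m')) addrA lu Dm'.
  by field; apply/andP.
have Dv' : v' = - v * l / m ^+ 3.
  apply: (mulfI m0); rewrite -[LHS]addr0 -(subrr (v * n')) addrA mv Dn'.
  by field.
split; first by rewrite Dm' Dl' Dn'; field; apply/andP.
apply/eqP; rewrite -subr_eq0 opprK.
rewrite (_ : _ + _ = - (2%:R * m * u - 2%:R * l * v - l * m + m ^+ 2) / (l * m ^+ 3)).
  by rewrite E2 addNr oppr0 mul0r.
by rewrite Du' Dv' Dl' Dm'; field; apply/andP.
Qed.


Lemma upper_mul_diag (F : fieldType) n (C D : 'M[F]_n) i :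
  is_trig_mx C^T -> is_trig_mx D^T -> (C *m D) i i = C i i * D i i.
Proof.
move=> /is_trig_mxP Cup /is_trig_mxP Dup.
rewrite mxE (bigD1 i) //= big1 ?addr0 // => k; rewrite -val_eqE neq_ltn.
case/orP=> ik; [have := Cup _ _ ik | have := Dup _ _ ik]; rewrite mxE => ->.
  by rewrite mul0r.
by rewrite mulr0.
Qed.

(** Only indices between [i] and [j] contribute, and [j] is the successor of [i]. *)
Lemma upper_mul_superdiag (F : fieldType) n (C D : 'M[F]_n) (i j : 'I_n) :
    is_trig_mx C^T -> is_trig_mx D^T -> i.+1 = j ->
  (C *m D) i j = C i i * D i j + C i j * D j j.
Proof.
move=> /is_trig_mxP Cup /is_trig_mxP Dup ij.
have ji : j != i by rewrite -val_eqE /= -ij neq_ltn leqnn orbT.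
rewrite mxE (bigD1 i) //= (bigD1 j) //= big1 ?addr0 // => k /andP[ki kj].
have [ik|ik] : (k < i)%N \/ (j < k)%N.
- apply/orP; move: ki kj; rewrite -!val_eqE /= -ij ltn_neqAle => /negPf-> kj.
  by rewrite [(i.+1 < k)%N]ltn_neqAle eq_sym kj /= ltnNge orbN.
- by have := Cup _ _ ik; rewrite mxE => ->; rewrite mul0r.
- by have := Dup _ _ ik; rewrite mxE => ->; rewrite mulr0.
Qed.

(** The two conditions involve only the diagonal and the first superdiagonal, so the corresponding
    entries of [C *m D = 1] transfer them to the inverse. *)
Lemma hilbert_gens_V5_borel_inv (F : fieldType) p (C : 'M[F]_5) :
    prime p -> (5 < p)%N -> p \in [pchar F] -> C \in unitmx -> is_trig_mx C^T ->
    let c i j := C (inord i) (inord j) in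
    c 2 2 ^+ 2 = c 1 1 * c 3 3 ->
    2%:R * c 2 2 * c 1 2 - 2%:R * c 1 1 * c 2 3 - c 1 1 * c 2 2
      = - c 2 2 ^+ 2 ->
  forall f, ideal_gen (fun h => h \in hilbert_gens_V5 F p) f ->
    ideal_gen (fun h => h \in hilbert_gens_V5 F p) (lin_subst (invmx C) f).
Proof.
move=> p_pr p_gt5 pF Cu Cup c Ed Eo; set D := invmx C.
have CD : C *m D = 1%:M by rewrite mulmxV.
have Dup : is_trig_mx D^T.
  by apply: (trig_mx_rinv Cup); rewrite -trmx_mul mulVmx // trmx1.
have diagE i : C i i * D i i = 1 by rewrite -upper_mul_diag // CD mxE eqxx.
have superE k : (k.+1 < 5)%N -> let i := inord k in let j := inord k.+1 in
    C i i * D i j + C i j * D j j = 0.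
  move=> k5 i j; have ij : i.+1 = j by rewrite !inordK // ltnW.
  by rewrite -upper_mul_superdiag // CD mxE -val_eqE /= -ij ltn_eqF.
have [Ed' Eo'] := borel_condition_inv (diagE _) (diagE _) (diagE _)
  (superE 1 isT) (superE 2 isT) Ed Eo.
exact: hilbert_gens_V5_borel.
Qed.

Lemma lower_mul_borel_stab (F : fieldType) (A : 'M[F]_5) :
    A \in unitmx -> (borel_locus F).@[fun k => mxvec A 0 k] != 0 ->
  exists B C : 'M[F]_5, let c i j := C (inord i) (inord j) in
    [/\ A = B *m C, is_trig_mx B, C \in unitmx, is_trig_mx C^T &
    [/\ c 2 2 ^+ 2 = c 1 1 * c 3 3 &
    2%:R * c 2 2 * c 1 2 - 2%:R * c 1 1 * c 2 3 - c 1 1 * c 2 2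
      = - c 2 2 ^+ 2]].
Proof.
move=> Au /generic_lu[L [U [DA Ltrig Utrig U1]]].
set e := _ - _ => e0.
(* Scaling the rows of [U] by [d] gives [c 1 1 = e^-1], [c 2 2 = 1], [c 3 3 = e], so the first
   equation holds; the second then reads [e^-1 * (- e) = -1]. *)
pose d i := [:: 1; e^-1; 1; e; 1]`_i : F.
pose D := diag_mx (\row_(i < 5) d i); pose D' := diag_mx (\row_(i < 5) (d i)^-1).
have d0 (i : 'I_5) : d i != 0.
  by case: i => [[|[|[|[|[|i]]]]] i5]; rewrite /d //= ?oner_eq0 ?invr_eq0.
have D'D : D' *m D = 1%:M.
  apply/matrixP => i j; rewrite mul_diag_mx !mxE.
  by case: eqP => _; rewrite ?mulr0n ?mulr0 // mulr1n mulVf.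
have Uu : U \in unitmx.
  rewrite unitmxE -det_tr det_trig // big1 ?unitr1 // => i _.
  by rewrite mxE U1.
exists (L *m D'), (D *m U) => c.
have cE i j : (i < 5)%N -> c i j = d i * U (inord i) (inord j).
  by move=> i5; rewrite /c mul_diag_mx !mxE inordK.
split.
- by rewrite mulmxA -(mulmxA L) D'D mulmx1.
- apply/is_trig_mxP => i j ij; rewrite mul_mx_diag mxE.
  by rewrite (is_trig_mxP Ltrig) ?mul0r.
- rewrite unitmx_mul Uu andbT; case/mulmx1_unit: D'D => //.
- apply/is_trig_mxP => i j ij; rewrite mxE mul_diag_mx mxE.
  by have := is_trig_mxP Utrig i j ij; rewrite mxE => ->; rewrite mulr0.
rewrite !cE // !U1 /d /=; split; first by field.
apply/eqP; rewrite -subr_eq0; apply/eqP.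
rewrite (_ : _ - _ = 1 - e^-1 * e); first by rewrite mulVf ?subrr.
by rewrite [in RHS]/e; ring.
Qed.

(** * The generic initial ideal *)

Unset Implicit Arguments.

Theorem mainTheorem5 (p : nat) (F : fieldType) (gT : finGroupType)
    (G : {group gT}) (rG : mx_representation F G 5) (mo : rel 'X_{1..5}) :
  prime p -> (5 < p)%N -> p \in [pchar F] -> infinite_type F ->
  cyclic G -> #|G| = p ->
  is_jordan_module rG ->
  triangular_basis rG ->
  (forall f, hilbert_ideal rG f <->
             ideal_gen (fun h => h \in hilbert_gens_V5 F p) f) ->
  monomial_order mo ->
  (forall i j : 'I_5, (i < j)%N -> mo U_(j)%MM U_(i)%MM) ->
  is_gin mo (hilbert_ideal rG) (initial_ideal mo (hilbert_ideal rG)).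
Proof.
move=> p_pr p_gt5 pF _ _ _ _ _ HE mo_ord mo_var.
(* The open set does not depend on [mo]: one choice serves every monomial order. *)
exists (fun A => A \in unitmx /\ (borel_locus F).@[fun k => mxvec A 0 k] != 0).
split.
- exists (fun f => f = borel_locus F) => A.
  by split=> [[Au PA]|[Au [_ -> PA]]]; split=> //; exists (borel_locus F).
- by exists 1%:M; split; [apply: unitmx1 | apply: borel_locus1].
move=> A [Au /(lower_mul_borel_stab Au)[B [C [DA Btrig Cu Cup [Ed Eo]]]]] g.
rewrite DA; apply: (initial_ideal_lower_stab mo_ord mo_var Btrig _ (mulmxV Cu)).
- have : \det B != 0.
    by move: Au; rewrite DA unitmxE det_mulmx unitfE mulf_eq0 => /norP[].
  by rewrite det_trig // => /prodf_neq0 Bnz j; apply: Bnz.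
- by move=> f /HE Hf; apply/HE; apply: hilbert_gens_V5_borel.
- by move=> f /HE Hf; apply/HE; apply: hilbert_gens_V5_borel_inv.
Qed.
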